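(* Define the matrices $x_{01}=A\Phi\Psi^{-1}$, $x_{12}=B\Phi^{-1}$, $x_{23}=A^*\Phi\Psi$, $x_{30}=B^*\Phi^{-1}$, $x_{02}=K\Psi^{-1}$, $x_{20}=\Psi K^{-1}$, $x_{13}=K^*\Psi$, $x_{31}=\Psi^{-1}(K^* )^{-1}$ (the action on $V$ of the generators of the $q$-tetrahedron algebra $\boxtimes_q$), and let $x'_{ij}$ be the matrix obtained in the same way with $q$ replaced by $q'=-q$. (i) If $b>1$ then $\overline{x_{ij}}=x_{ij}$ for each of these eight matrices. (ii) If $b<-1$ then $\overline{x_{ij}}=x'_{ij}$ for each of these eight matrices.
   Context: Let $\Gamma=(X,R)$ be a finite, undirected, connected, distance-regular graph without loops or multiple edges, with path-length distance $\partial$, diameter $D\ge3$, intersection numbers $c_i,b_i$. Fix $b,\beta\in\mathbb C$ with $b\ne1$ and assume $\Gamma$ has classical parameters $(D,b,\alpha,\beta)$ with $\alpha=b-1$, i.e. $c_i=b^{i-1}\frac{b^i-1}{b-1}$, $b_i=(\beta+1-b^i)\frac{b^D-b^i}{b-1}$ ($0\le i\le D$); $b$ is then an integer, $b\ne0,-1$. Fix $q\in\mathbb C$ with $q^2=b$. Let $E_0,\dots,E_D$ be the primitive idempotents of the Bose–Mesner algebra ordered so that Krein parameters equal intersection numbers; $\Gamma$ is $Q$-polynomial for this ordering. Let $V=\mathbb C X$ with Hermitian form $\langle u,v\rangle=u^t\overline v$. Fix a vertex $x$; $E^*_i$ is the diagonal matrix with $(y,y)$-entry $1$ if $\partial(x,y)=i$,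 else $0$. For $-1\le i,j\le D$: $V^{\downarrow\downarrow}_{i,j}=(E^*_0V+\dots+E^*_iV)\cap(E_0V+\dots+E_jV)$, $V^{\uparrow\downarrow}_{i,j}=(E^*_DV+\dots+E^*_{D-i}V)\cap(E_0V+\dots+E_jV)$, $V^{\downarrow\uparrow}_{i,j}=(E^*_0V+\dots+E^*_iV)\cap(E_DV+\dots+E_{D-j}V)$, $V^{\uparrow\uparrow}_{i,j}=(E^*_DV+\dots+E^*_{D-i}V)\cap(E_DV+\dots+E_{D-j}V)$ (zero if $i=-1$ or $j=-1$). For $0\le i,j\le D$, $\tilde V^{\mu\nu}_{i,j}$ is the orthogonal complement of $V^{\mu\nu}_{i-1,j}+V^{\mu\nu}_{i,j-1}$ in $V^{\mu\nu}_{i,j}$; for each $\mu,\nu$, $V=\bigoplus_{i,j}\tilde V^{\mu\nu}_{i,j}$. Define $A=\sum_{i=0}^Dq^{D-2i}E_i$, $A^*=\sum_{i=0}^Dq^{D-2i}E^*_i$, and $B,B^*,K,K^*,\Phi,\Psi$ as the unique matrices such that for all $0\le i,j\le D$: $B=q^{i-j}I$ on $\tilde V^{\downarrow\uparrow}_{i,j}$; $B^*=q^{j-i}I$ on $\tilde V^{\uparrow\downarrow}_{i,j}$; $K=q^{i-j}I$ on $\tilde V^{\downarrow\downarrow}_{i,j}$; $K^*=q^{i-j}I$ on $\tilde V^{\uparrow\uparrow}_{i,j}$; $\Phi=q^{i+j-D}I$ on $\tilde V^{\downarrow\downarrow}_{i,j}$; $\Psi=q^{i+j-D}I$ on $\tilde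 V^{\downarrow\uparrow}_{i,j}$. *)

(* Defs.v *)
From HB Require Import structures.
From mathcomp Require Import all_boot all_order all_algebra.
From mathcomp Require Import reals complex.

Set Implicit Arguments.
Unset Strict Implicit.
Unset Printing Implicit Defensive.

Import Order.TTheory GRing.Theory Num.Theory.

Local Open Scope ring_scope.

Section Graph.
Variables (X : finType) (e : rel X).

Definition walk (k : nat) (y z : X) : bool :=
  [exists s : k.-tuple X, path e y s && (last y s == z)].

(* Least length of a walk from y to z; the junk value #|X| if there is none. *)
Definition gdist (y z : X) : nat := find (fun k => walk k y z) (iota 0 #|X|).

Definition diameter : nat := \max_(y : X) \max_(z : X) gdist y z.

Definition connected_graph : Prop := forall y z, connect e y z.

(* p h i j is the intersection number p^h_{ij}.  The values p h i j with h
   larger than the diameter are unconstrained and never used. *)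
Definition distance_regular (p : nat -> nat -> nat -> nat) : Prop :=
  forall (h i j : nat) (y z : X), gdist y z = h ->
    #|[set w | (gdist y w == i) && (gdist z w == j)]| = p h i j.

End Graph.

(* For i = 0 this is p^0_{10} = 0, in accordance with c_0 = 0. *)
Definition c_num (p : nat -> nat -> nat -> nat) (i : nat) : nat := p i 1%N i.-1.

Definition b_num (p : nat -> nat -> nat -> nat) (i : nat) : nat := p i 1%N i.+1.

(* Classical parameters (D, b, alpha, beta) with alpha = b - 1: these are
   c_i = [i] (1 + alpha [i-1]) and b_i = ([D] - [i]) (beta - alpha [i]), where
   [i] = (b^i - 1) / (b - 1), after substituting alpha. *)
Definition classical_parameters (C : fieldType) (p : nat -> nat -> nat -> nat)
    (D : nat) (b beta : C) : Prop :=
  forall i : nat, (i <= D)%N ->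
    (c_num p i)%:R = b ^ (i%:Z - 1) * ((b ^+ i - 1) / (b - 1)) /\
    (b_num p i)%:R = (beta + 1 - b ^+ i) * ((b ^+ D - b ^+ i) / (b - 1)).

Section BoseMesner.
(* Matrices and vectors indexed by X are indexed by 'I_#|X| through enum_val. *)
Variables (C : numClosedFieldType) (X : finType) (e : rel X) (D : nat).

Definition dist_mx (i : nat) : 'M[C]_#|X| :=
  \matrix_(y, z) (gdist e (enum_val y) (enum_val z) == i)%:R.

Definition bose_mesner : {vspace 'M[C]_#|X|} :=
  (\sum_(i < D.+1) <[dist_mx i]>)%VS.

Definition idempotent_in (M : {vspace 'M[C]_#|X|}) (F : 'M[C]_#|X|) : Prop :=
  F \in M /\ F *m F = F.

Definition primitive_idempotent (M : {vspace 'M[C]_#|X|})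
    (F : 'M[C]_#|X|) : Prop :=
  [/\ idempotent_in M F,
      F != 0
    & forall G H : 'M[C]_#|X|, idempotent_in M G -> idempotent_in M H ->
        G *m H = 0 -> H *m G = 0 -> F = G + H -> G = 0 \/ H = 0].

Definition primitive_idempotents (E : 'I_D.+1 -> 'M[C]_#|X|) : Prop :=
  injective E /\
  forall F, primitive_idempotent bose_mesner F <-> exists i, F = E i.

(* kr h i j is the Krein parameter q^h_{ij}. *)
Definition krein_parameters (E : 'I_D.+1 -> 'M[C]_#|X|)
    (kr : 'I_D.+1 -> 'I_D.+1 -> 'I_D.+1 -> C) : Prop :=
  forall i j, map2_mx *%R (E i) (E j) =
    (#|X|%:R)^-1 *: \sum_(h < D.+1) kr h i j *: E h.

End BoseMesner.

Definition hermitian_form (C : numClosedFieldType) (n : nat)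
    (u v : 'cV[C]_n) : C :=
  (u^T *m map_mx Num.conj v) 0 0.

Inductive direction := Down | Up.

Section SplitDecompositions.
Variables (C : numClosedFieldType) (X : finType) (e : rel X) (D : nat).
Variables (E : 'I_D.+1 -> 'M[C]_#|X|) (x : X).

Definition dual_idempotent (i : 'I_D.+1) : 'M[C]_#|X| :=
  \matrix_(y, z) ((y == z) && (gdist e x (enum_val y) == i))%:R.

(* F_0 V + ... + F_i V for Down, F_D V + ... + F_{D-i} V for Up; the sums are
   empty for i = -1. *)
Definition partial_sum (mu : direction) (F : 'I_D.+1 -> 'M[C]_#|X|) (i : int) :
    {vspace 'cV[C]_#|X|} :=
  match mu with
  | Down => \sum_(k < D.+1 | (k%:Z <= i)%R) limg (linfun (mulmx (F k)))
  | Up => \sum_(k < D.+1 | (D%:Z - i <= k%:Z)%R) limg (linfun (mulmx (F k)))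
  end%VS.

(* The first arrow refers to the E^*_k, the second one to the E_k. *)
Definition Vspace (mu nu : direction) (i j : int) : {vspace 'cV[C]_#|X|} :=
  (partial_sum mu dual_idempotent i :&: partial_sum nu E j)%VS.

Definition in_Vtilde (mu nu : direction) (i j : int) (v : 'cV[C]_#|X|) : Prop :=
  v \in Vspace mu nu i j /\
  forall w, w \in (Vspace mu nu (i - 1) j + Vspace mu nu i (j - 1))%VS ->
    hermitian_form v w = 0.

Definition scalar_on_Vtilde (M : 'M[C]_#|X|) (mu nu : direction)
    (f : int -> int -> C) : Prop :=
  forall i j : nat, (i <= D)%N -> (j <= D)%N ->
    forall v, in_Vtilde mu nu i j v -> M *m v = f i j *: v.

Record split_matrices := SplitMatrices {
  mxB : 'M[C]_#|X|;
  mxBs : 'M[C]_#|X|;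
  mxK : 'M[C]_#|X|;
  mxKs : 'M[C]_#|X|;
  mxPhi : 'M[C]_#|X|;
  mxPsi : 'M[C]_#|X| }.

Record split_matrices_for (q : C) (S : split_matrices) : Prop := {
  mxBP : scalar_on_Vtilde (mxB S) Down Up (fun i j => q ^ (i - j));
  mxBsP : scalar_on_Vtilde (mxBs S) Up Down (fun i j => q ^ (j - i));
  mxKP : scalar_on_Vtilde (mxK S) Down Down (fun i j => q ^ (i - j));
  mxKsP : scalar_on_Vtilde (mxKs S) Up Up (fun i j => q ^ (i - j));
  mxPhiP : scalar_on_Vtilde (mxPhi S) Down Down (fun i j => q ^ (i + j - D%:Z));
  mxPsiP : scalar_on_Vtilde (mxPsi S) Down Up (fun i j => q ^ (i + j - D%:Z)) }.

Definition mxA (q : C) : 'M[C]_#|X| :=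
  \sum_(i < D.+1) q ^ (D%:Z - 2 * i%:Z) *: E i.

Definition mxAs (q : C) : 'M[C]_#|X| :=
  \sum_(i < D.+1) q ^ (D%:Z - 2 * i%:Z) *: dual_idempotent i.

Inductive tet_index := T01 | T12 | T23 | T30 | T02 | T20 | T13 | T31.

Definition tet_generator (q : C) (S : split_matrices) (r : tet_index) :
    'M[C]_#|X| :=
  match r with
  | T01 => mxA q *m mxPhi S *m invmx (mxPsi S)
  | T12 => mxB S *m invmx (mxPhi S)
  | T23 => mxAs q *m mxPhi S *m mxPsi S
  | T30 => mxBs S *m invmx (mxPhi S)
  | T02 => mxK S *m invmx (mxPsi S)
  | T20 => mxPsi S *m invmx (mxK S)
  | T13 => mxKs S *m mxPsi S
  | T31 => invmx (mxPsi S) *m invmx (mxKs S)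
  end.

End SplitDecompositions.

(* Main.v *)
Require Import Defs.
From HB Require Import structures.
From mathcomp Require Import all_boot all_order all_algebra.
From mathcomp Require Import boolp reals complex.

Set Implicit Arguments.
Unset Strict Implicit.
Unset Printing Implicit Defensive.

Import Order.TTheory GRing.Theory Num.Theory.

Local Open Scope ring_scope.

(** Complex conjugation fixes every [E_i]: in the commutative algebra of
    symmetric matrices [bose_mesner], distinct primitive idempotents have
    product zero, whereas [E_i] times its conjugate (which equals its conjugate
    transpose) is nonzero.  Hence conjugation preserves every [Vtilde], so the
    entrywise conjugate of [B], [K], [Phi], ... solves the defining equations
    of that matrix with [q] replaced by its conjugate.  As the [Vtilde] span
    the whole space, these solutions are unique.  Finally the conjugate of [q]
    is [q] if [b > 1] and [- q] if [b < -1]. *)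

(** * Path-length distance in an undirected graph *)

Section Distance.
Variables (X : finType) (e : rel X).
Hypothesis e_sym : symmetric e.

Lemma walk_sym k y z : walk e k y z = walk e k z y.
Proof.
suff imp u v : walk e k u v -> walk e k v u by apply/idP/idP; apply: imp.
case/existsP=> s /andP[pth /eqP <-]; apply/existsP.
(* The reversed walk visits all vertices of [u :: s] except the last one, backwards. *)
have sz : size (rev (belast u s)) == k by rewrite size_rev size_belast size_tuple.
exists (Tuple sz) => /=; rewrite rev_path.
rewrite (eq_path (e' := e)) ?pth => [|? ? /=]; last by rewrite e_sym.
by case: (tval s) => //= a s'; rewrite rev_cons last_rcons.
Qed.

Lemma gdist_sym y z : gdist e y z = gdist e z y.
Proof. by rewrite /gdist; apply: eq_find => k; rewrite walk_sym. Qed.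

Lemma gdist_eq0 y z : (gdist e y z == 0%N) = (y == z).
Proof.
have W0 : walk e 0 y z = (y == z).
  apply/existsP/idP => [[s]|yz]; last by exists [tuple]; rewrite /= yz.
  by rewrite tuple0.
(* The vertex [y] makes [X] nonempty, so the search for a walk really starts at length 0. *)
rewrite /gdist; case: #|X| (fintype0 y) => [/(_ erefl)//|n _] /=.
by rewrite W0; case: (y == z).
Qed.

Lemma gdist_diameter y z : (gdist e y z <= diameter e)%N.
Proof.
rewrite /diameter (leq_trans _ (leq_bigmax y)) //.
exact: (leq_bigmax (F := fun z => gdist e y z)).
Qed.

End Distance.

(** * The Hermitian form: definiteness, orthogonal projection, conjugation *)

Section HermitianForm.
Variables (C : numClosedFieldType) (n : nat).
Implicit Types (u v w : 'cV[C]_n).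

Lemma hermitian_formDl u v w :
  hermitian_form (u + v) w = hermitian_form u w + hermitian_form v w.
Proof. by rewrite /hermitian_form linearD mulmxDl mxE. Qed.

Lemma hermitian_formZl a u w : hermitian_form (a *: u) w = a * hermitian_form u w.
Proof. by rewrite /hermitian_form linearZ -scalemxAl mxE. Qed.

Lemma hermitian_formDr u v w :
  hermitian_form w (u + v) = hermitian_form w u + hermitian_form w v.
Proof. by rewrite /hermitian_form map_mxD mulmxDr mxE. Qed.

Lemma hermitian_formZr a u w :
  hermitian_form w (a *: u) = a^* * hermitian_form w u.
Proof. by rewrite /hermitian_form map_mxZ -scalemxAr mxE. Qed.

Lemma hermitian_form0r w : hermitian_form w 0 = 0.
Proof. by rewrite /hermitian_form map_mx0 mulmx0 mxE. Qed.

Lemma hermitian_form_conj u v :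
  hermitian_form (map_mx Num.conj u) (map_mx Num.conj v) = (hermitian_form u v)^*.
Proof.
rewrite /hermitian_form !mxE rmorph_sum.
by apply: eq_bigr => i _; rewrite !mxE rmorphM.
Qed.

Lemma hermitian_form_eq0 u : hermitian_form u u = 0 -> u = 0.
Proof.
rewrite /hermitian_form mxE => /eqP; rewrite psumr_eq0 => [|i _]; last first.
  by rewrite !mxE mul_conjC_ge0.
move/allP=> u0; apply/matrixP=> i j; rewrite ord1 mxE.
by have := u0 i (mem_index_enum i); rewrite !mxE mul_conjC_eq0 => /eqP.
Qed.

(** Gram-Schmidt along a basis of [W]: the projection onto [<<a :: s>>] is the projection onto
    [<<s>>] plus a component along [t], the part of [a] orthogonal to [<<s>>]. *)
Lemma orthogonal_decomposition (W : {vspace 'cV[C]_n}) v :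
  exists2 w, w \in W & forall w', w' \in W -> hermitian_form (v - w) w' = 0.
Proof.
rewrite -(span_basis (vbasisP W)); move: (tval _) => s.
elim: s v => [|a s IH] v.
  exists 0; first by rewrite mem0v.
  move=> w'; rewrite span_nil memv0 => /eqP->.
  by rewrite hermitian_form0r.
have [w ws w_orth] := IH v; have [a' a's a'_orth] := IH a.
have sub : (<<s>> <= <<a :: s>>)%VS by rewrite span_cons addvSr.
set t := a - a' in a'_orth *.
set c := hermitian_form (v - w) t / hermitian_form t t.
have t_in : t \in <<a :: s>>%VS.
  by apply: memvB; [rewrite memv_span ?mem_head | apply: subvP a's].
exists (w + c *: t); first by rewrite memvD ?memvZ // (subvP sub).
move=> w'; rewrite span_cons => /memv_addP[_ /vlineP[k ->] [z zs ->]].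
(* In terms of [t], only the multiple of [t] matters: both [v - w] and [t] are orthogonal to the
   remaining summand, which lies in [<<s>>]. *)
have -> : k *: a + z = k *: t + (k *: a' + z).
  by rewrite addrA -scalerDr subrK.
have z's : k *: a' + z \in <<s>>%VS by rewrite memvD ?memvZ.
rewrite opprD addrA -scaleNr hermitian_formDl hermitian_formZl.
rewrite !(hermitian_formDr (k *: t)) !hermitian_formZr.
rewrite (w_orth _ z's) (a'_orth _ z's) !addr0.
rewrite mulrCA -mulrDr mulNr.
(* The division in [c] is degenerate only if [t = 0], and then every term vanishes. *)
have [t0|t0] := eqVneq (hermitian_form t t) 0.
  by rewrite (hermitian_form_eq0 t0) !hermitian_form0r mulr0 subrr mulr0.
by rewrite divfK // subrr mulr0.
Qed.

Lemma map_conjK (m k : nat) (N : 'M[C]_(m, k)) :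
  map_mx Num.conj (map_mx Num.conj N) = N.
Proof. by apply/matrixP=> i j; rewrite !mxE conjCK. Qed.

(** The diagonal entries of the product are the squared norms of the columns of [N]. *)
Lemma mul_conj_tr_eq0 (N : 'M[C]_n) : N^T *m map_mx Num.conj N = 0 -> N = 0.
Proof.
move=> NN0; apply/matrixP=> i j.
suff /matrixP/(_ i 0) : col j N = 0 by rewrite !mxE.
apply: hermitian_form_eq0; move/matrixP/(_ j j): NN0; rewrite !mxE => <-.
by rewrite /hermitian_form mxE; apply: eq_bigr => k _; rewrite !mxE.
Qed.

End HermitianForm.

(** * The Bose-Mesner algebra and its primitive idempotents *)

Section BoseMesnerAlgebra.
Variables (C : numClosedFieldType) (X : finType) (e : rel X) (D : nat).
Variable (p : nat -> nat -> nat -> nat).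
Hypothesis e_sym : symmetric e.
Hypothesis diam : diameter e = D.
Hypothesis dreg : distance_regular e p.

Let d (y z : 'I_#|X|) := gdist e (enum_val y) (enum_val z).
Let BM := bose_mesner C e D.

Let d_ltD y z : (d y z < D.+1)%N.
Proof. by rewrite ltnS -diam gdist_diameter. Qed.

(** Working form of membership: the coefficient of [dist_mx C e i] is the common entry at distance
    [i]. *)
Lemma bose_mesnerP (N : 'M[C]_#|X|) :
  reflect (exists f : nat -> C, N = \matrix_(y, z) f (d y z)) (N \in BM).
Proof.
apply: (iffP memv_sumP) => [[Ni Ni_in ->]|[f ->]].
  have /choice[f fP] : forall i : 'I_D.+1, exists a, Ni i = a *: dist_mx C e i.
    by move=> i; apply/vlineP/Ni_in.
  exists (fun k : nat => \sum_(i < D.+1) f i * (k == i :> nat)%:R).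
  apply/matrixP=> y z; rewrite summxE mxE; apply: eq_bigr => i _.
  by rewrite fP !mxE.
exists (fun i : 'I_D.+1 => f i *: dist_mx C e i) => [i _|].
  by rewrite memvZ ?memv_line.
apply/matrixP=> y z; rewrite summxE mxE (bigD1 (Ordinal (d_ltD y z))) //=.
rewrite !mxE eqxx mulr1 big1 ?addr0 // => i neq; rewrite !mxE.
case: eqP => [eq|_]; last by rewrite mulr0.
by case/eqP: neq; apply: val_inj.
Qed.

Lemma bose_mesner_tr N : N \in BM -> N^T = N.
Proof.
case/bose_mesnerP=> f ->; apply/matrixP=> y z.
by rewrite !mxE /d gdist_sym.
Qed.

Lemma bose_mesner_conj N : N \in BM -> map_mx Num.conj N \in BM.
Proof.
case/bose_mesnerP=> f ->; apply/bose_mesnerP; exists (fun k => (f k)^*).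
by apply/matrixP=> y z; rewrite !mxE.
Qed.

(** Sort the vertices [w] in the sum for entry [(y, z)] by their distances [i] and [j] to [y] and
    [z]: each class has [p h i j] members, where [h] is the distance of [y] and [z], so the entry
    depends on [h] only. *)
Lemma bose_mesner_mul N N' : N \in BM -> N' \in BM -> N *m N' \in BM.
Proof.
case/bose_mesnerP=> f -> /bose_mesnerP[g ->]; apply/bose_mesnerP.
exists (fun k => \sum_(i < D.+1) \sum_(j < D.+1) (f i * g j) *+ p k i j).
apply/matrixP=> y z; rewrite !mxE.
(* Each multiple by an intersection number becomes a sum over the vertices it counts, and the sum
   over [w] is then moved outside. *)
under [RHS]eq_bigr => i _.
  under eq_bigr => j _.
    rewrite -(@dreg _ i j (enum_val y) (enum_val z) erefl).
    rewrite -sumr_const.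
    over.
  over.
rewrite /=.
under [RHS]eq_bigr => i _ do under eq_bigr => j _ do
  rewrite big_mkcond /= (big_enum_val (A := X)) /=.
under [RHS]eq_bigr => i _ do rewrite exchange_big /=.
rewrite exchange_big /=; apply: eq_bigr => w _.
(* A fixed [w] contributes only to the pair of its own distances to [y] and [z]. *)
rewrite !mxE (bigD1 (Ordinal (d_ltD y w))) //= (bigD1 (Ordinal (d_ltD z w))) //=.
rewrite inE !eqxx /= {2}/d (gdist_sym e_sym (enum_val w)).
rewrite [X in _ = _ + X]big1 ?addr0 => [|i neq]; last first.
  apply: big1 => j _; rewrite inE; case: eqP => //= eq.
  by case/eqP: neq; apply: val_inj.
rewrite big1 ?addr0 // => j neq; rewrite inE andbC; case: eqP => //= eq.
by case/eqP: neq; apply: val_inj.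
Qed.

(** The product of two members is again a member, hence symmetric, and transposing it swaps the
    factors. *)
Lemma bose_mesner_comm N N' : N \in BM -> N' \in BM -> N *m N' = N' *m N.
Proof.
move=> NB N'B; rewrite -[LHS]bose_mesner_tr ?bose_mesner_mul //.
by rewrite trmx_mul !bose_mesner_tr.
Qed.

Lemma bose_mesner1 : 1%:M \in BM.
Proof.
apply/bose_mesnerP; exists (fun k => (k == 0%N)%:R).
by apply/matrixP=> y z; rewrite !mxE /d gdist_eq0 (inj_eq enum_val_inj).
Qed.

Lemma idempotent_in_conj N :
  idempotent_in BM N -> idempotent_in BM (map_mx Num.conj N).
Proof. by case=> NB NN; split; rewrite ?bose_mesner_conj // -map_mxM NN. Qed.

(** Conjugation is an involutive ring automorphism preserving the algebra, so a splitting of the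
    conjugate would conjugate back to a splitting of [N]. *)
Lemma primitive_idempotent_conj N :
  primitive_idempotent BM N -> primitive_idempotent BM (map_mx Num.conj N).
Proof.
case=> NI N0 Nprim; split; first exact: idempotent_in_conj.
  by rewrite map_mx_eq0.
move=> G H GI HI GH HG NE.
have [] := Nprim _ _ (idempotent_in_conj GI) (idempotent_in_conj HI).
- by rewrite -map_mxM GH map_mx0.
- by rewrite -map_mxM HG map_mx0.
- by rewrite -map_mxD -NE map_conjK.
- by move/eqP; rewrite map_mx_eq0 => /eqP; left.
- by move/eqP; rewrite map_mx_eq0 => /eqP; right.
Qed.

Lemma idempotent_in_mul N N' :
  idempotent_in BM N -> idempotent_in BM N' -> idempotent_in BM (N *m N').
Proof.
case=> NB NN [N'B NN']; split; first exact: bose_mesner_mul.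
by rewrite mulmxA -(mulmxA N) -(bose_mesner_comm NB) // mulmxA NN -mulmxA NN'.
Qed.

Lemma idempotent_in_sub N N' :
  idempotent_in BM N -> idempotent_in BM N' -> N *m N' = N' ->
  idempotent_in BM (N - N').
Proof.
move=> [NB NN] [N'B NN'] NN'E; split; first by rewrite memvB.
rewrite mulmxBl !mulmxBr NN NN' NN'E (bose_mesner_comm N'B NB) NN'E.
by rewrite subrr subr0.
Qed.

(** The splitting of [N] into the orthogonal idempotents [N *m N'] and [N - N *m N'] must be
    trivial. *)
Lemma primitive_idempotent_mul_or N N' :
  primitive_idempotent BM N -> idempotent_in BM N' ->
  N *m N' = 0 \/ N *m N' = N.
Proof.
case=> NI N0 Nprim N'I; have PI := idempotent_in_mul NI N'I.
have NP : N *m (N *m N') = N *m N' by case: NI => _ NN; rewrite mulmxA NN.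
have PN : N *m N' *m N = N *m N'.
  by rewrite (bose_mesner_comm PI.1 NI.1).
have [] := Nprim _ _ PI (idempotent_in_sub NI PI NP).
- by rewrite mulmxBr PN PI.2 subrr.
- by rewrite mulmxBl NP PI.2 subrr.
- by rewrite addrC subrK.
- by left.
- by move/eqP; rewrite subr_eq0 => /eqP; right.
Qed.

Lemma primitive_idempotent_orthogonal N N' :
  primitive_idempotent BM N -> primitive_idempotent BM N' ->
  N *m N' = 0 \/ N = N'.
Proof.
move=> NP N'P; have [NI _ _] := NP; have [N'I _ _] := N'P.
have [|NE] := primitive_idempotent_mul_or NP N'I; first by left.
have [N'N|N'E] := primitive_idempotent_mul_or N'P NI.
  by left; rewrite (bose_mesner_comm NI.1 N'I.1).
by right; rewrite -[LHS]NE (bose_mesner_comm NI.1 N'I.1).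
Qed.

Lemma primitive_idempotent_real N :
  primitive_idempotent BM N -> map_mx Num.conj N = N.
Proof.
move=> NP; have [NI N0 _] := NP.
have [NN|//] := primitive_idempotent_orthogonal NP (primitive_idempotent_conj NP).
(* By symmetry of [N] the vanishing product is [N^T] times the conjugate of [N]. *)
by move: NN N0; rewrite -{1}(bose_mesner_tr NI.1) => /mul_conj_tr_eq0->; rewrite eqxx.
Qed.

(** Induction on the rank: a nonprimitive [N] splits into nonzero orthogonal idempotents [G] and
    [H], and a primitive idempotent below [G] is also below [N]. *)
Lemma exists_primitive_idempotent N :
  idempotent_in BM N -> N != 0 ->
  exists2 F, primitive_idempotent BM F & F *m N = F.
Proof.
have [r] := ubnP (\rank N); elim: r N => // r IH N rkN NI N0.
have [NP|NnP] := pselect (primitive_idempotent BM N).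
  by exists N => //; case: NI.
suff [G [H [GI GH HG [G0 H0] NE]]] : exists G H, [/\ idempotent_in BM G,
    G *m H = 0, H *m G = 0, G != 0 /\ H != 0 & N = G + H].
  have GN : G *m N = G by rewrite NE mulmxDr GH addr0; case: GI.
  have GsN : (G <= N)%MS by rewrite -GN submxMl.
  (* With equal ranks, [N = Q *m G] for some [Q], so [N *m H = 0]; but [N *m H = H], against
     [H != 0]. *)
  have rkG : (\rank G < r)%N.
    rewrite -ltnS (leq_trans _ rkN) // ltnS ltn_neqAle mxrankS // andbT.
    apply: contra_neq H0 => rkE.
    have /submxP[Q NQ] : (N <= G)%MS.
      by rewrite -(mxrank_leqif_sup GsN) rkE.
    have : N *m N = N by case: NI.
    rewrite {2}NE mulmxDr (_ : N *m G = G) => [|].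
      by rewrite {2}NE => /addrI; rewrite {1}NQ -mulmxA GH mulmx0.
    by rewrite NE mulmxDl HG addr0; case: GI.
  have [F FP FG] := IH G rkG GI G0.
  by exists F => //; rewrite -FG -mulmxA GN.
apply: contrapT => none; apply: NnP; split=> // G H GI HI GH HG NE.
have [->|/eqP G0] := pselect (G = 0); first by left.
have [->|/eqP H0] := pselect (H = 0); first by right.
by case: none; exists G, H.
Qed.

(** The defect [1%:M - \sum_i E i] is idempotent. If nonzero, it would lie above some primitive
    idempotent [E i], yet every [E i] annihilates it. *)
Lemma sum_primitive_idempotents (E : 'I_D.+1 -> 'M[C]_#|X|) :
  primitive_idempotents e E -> \sum_i E i = 1%:M.
Proof.
case=> E_inj E_prim.
have EP i : primitive_idempotent BM (E i) by apply/E_prim; exists i.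
have ES i : E i *m (\sum_j E j) = E i.
  rewrite mulmx_sumr (bigD1 i) //= big1 => [|j ji].
    by rewrite addr0; case: (EP i) => -[].
  have [//|/E_inj ij] := primitive_idempotent_orthogonal (EP i) (EP j).
  by rewrite ij eqxx in ji.
have SI : idempotent_in BM (\sum_i E i).
  split; first by rewrite memv_suml // => i _; case: (EP i) => -[].
  by rewrite mulmx_suml; apply: eq_bigr => i _; rewrite ES.
have I1 : idempotent_in BM 1%:M by split; rewrite ?mul1mx ?bose_mesner1.
have TI : idempotent_in BM (1%:M - \sum_i E i).
  by apply: idempotent_in_sub; rewrite ?mul1mx.
apply/eqP; rewrite eq_sym -subr_eq0; apply/negPn/negP => T0.
have [F FP] := exists_primitive_idempotent TI T0.
have [_ F0 _] := FP; have /E_prim[i FE] := FP.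
by rewrite FE mulmxBr mulmx1 ES subrr => EF; rewrite FE -EF eqxx in F0.
Qed.

End BoseMesnerAlgebra.

(** * Split decompositions: uniqueness of the matrices acting by scalars, and conjugation *)

Section Spanning.
Variables (C : numClosedFieldType) (X : finType) (e : rel X) (D : nat).
Variables (E : 'I_D.+1 -> 'M[C]_#|X|) (x : X).

Lemma sum_dual_idempotents :
  diameter e = D -> \sum_(i < D.+1) dual_idempotent C e x i = 1%:M.
Proof.
move=> diam; apply/matrixP=> y z; rewrite summxE.
have dD : (gdist e x (enum_val y) < D.+1)%N.
  by rewrite ltnS -diam gdist_diameter.
rewrite (bigD1 (Ordinal dD)) //= big1 => [|i neq]; rewrite !mxE.
  by rewrite eqxx andbT addr0.
case: eqP => // _; case: eqP => // eq; case/eqP: neq; exact: val_inj.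
Qed.

Lemma conj_dual_idempotent (i : 'I_D.+1) :
  map_mx Num.conj (dual_idempotent C e x i) = dual_idempotent C e x i.
Proof. by apply/matrixP=> y z; rewrite !mxE rmorph_nat. Qed.

(** Puts the direction into the index condition, so that both directions share one sum. *)
Lemma partial_sumE mu (F : 'I_D.+1 -> 'M[C]_#|X|) i :
  partial_sum mu F i = (\sum_(k < D.+1 |
    match mu with Down => (k%:Z <= i)%R | Up => (D%:Z - i <= k%:Z)%R end)
    limg (linfun (mulmx (F k))))%VS.
Proof. by case: mu. Qed.

Lemma partial_sum_lt0 mu (F : 'I_D.+1 -> 'M[C]_#|X|) (i : int) :
  i < 0 -> partial_sum mu F i = 0%VS.
Proof.
move=> i0; rewrite partial_sumE big_pred0 // => k.
case: mu; apply/negbTE; rewrite -ltNge; first exact: lt_le_trans i0 _.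
by rewrite ltrBrDr (lt_le_trans (y := k%:Z)) ?gtrDl // lez_nat -ltnS.
Qed.

Lemma partial_sum_full mu (F : 'I_D.+1 -> 'M[C]_#|X|) :
  \sum_k F k = 1%:M -> partial_sum mu F D = fullv.
Proof.
move=> F1; rewrite partial_sumE; apply/eqP; rewrite eqEsubv subvf.
apply/subvP=> v _; rewrite -[v]mul1mx -F1 mulmx_suml memv_suml // => k _.
rewrite (subvP (sumv_sup k _ (subvv _))) //.
  by case: mu; rewrite ?subrr // lez_nat -ltnS.
by apply/memv_imgP; exists v; rewrite ?memvf ?lfunE.
Qed.

Lemma partial_sumS mu (F : 'I_D.+1 -> 'M[C]_#|X|) (i j : int) :
  i <= j -> (partial_sum mu F i <= partial_sum mu F j)%VS.
Proof.
move=> ij; rewrite !partial_sumE; apply/subv_sumP => k Pk.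
apply: (sumv_sup k) => //; case: mu Pk => [ki|]; first exact: le_trans ij.
by apply: le_trans; rewrite lerB.
Qed.

Lemma partial_sum_conj mu (F : 'I_D.+1 -> 'M[C]_#|X|) i v :
  (forall k, map_mx Num.conj (F k) = F k) ->
  v \in partial_sum mu F i -> map_mx Num.conj v \in partial_sum mu F i.
Proof.
move=> Freal; rewrite !partial_sumE => /memv_sumP[w wP ->].
rewrite raddf_sum memv_suml // => k Pk.
rewrite (subvP (sumv_sup k Pk (subvv _))) //.
have /memv_imgP[u _ ->] := wP k Pk; rewrite lfunE /= map_mxM Freal.
by apply/memv_imgP; exists (map_mx Num.conj u); rewrite ?memvf ?lfunE.
Qed.

Lemma VspaceS mu nu (i i' j j' : int) : i <= i' -> j <= j' ->
  (Vspace e E x mu nu i j <= Vspace e E x mu nu i' j')%VS.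
Proof. by move=> ii jj; rewrite capvS ?partial_sumS. Qed.

Lemma Vspace_lt0 mu nu (i j : int) :
  (i < 0) || (j < 0) -> Vspace e E x mu nu i j = 0%VS.
Proof.
by case/orP=> lt0; rewrite /Vspace (partial_sum_lt0 _ _ lt0) ?cap0v ?capv0.
Qed.

Hypothesis diam : diameter e = D.
Hypothesis E1 : \sum_i E i = 1%:M.

Lemma scalar_on_Vtilde_uniq mu nu f (N N' : 'M[C]_#|X|) :
  scalar_on_Vtilde e E x N mu nu f -> scalar_on_Vtilde e E x N' mu nu f -> N = N'.
Proof.
move=> NP N'P.
(* Agreement is proved on every [Vspace] by induction on [i + j]; the one with [i = j = D] is the
   whole space. *)
suff V_eq n (i j : nat) v : (i + j < n)%N -> (i <= D)%N -> (j <= D)%N ->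
    v \in Vspace e E x mu nu i j -> N *m v = N' *m v.
  have full (v : 'cV_#|X|) : N *m v = N' *m v.
    apply: (V_eq (D + D).+1 D D) => //.
    by rewrite memv_cap !partial_sum_full ?memvf ?sum_dual_idempotents.
  apply/matrixP=> y z; have /matrixP/(_ y 0) := full (delta_mx z 0).
  by rewrite -!colE !mxE.
elim: n i j v => // n IH i j v ltn iD jD vV.
set W := (Vspace e E x mu nu (i%:Z - 1) j + Vspace e E x mu nu i (j%:Z - 1))%VS.
have W_eq w : w \in W -> N *m w = N' *m w.
  case/memv_addP=> u uV [u' u'V ->]; rewrite !mulmxDr; congr (_ + _).
    (* For [i = 0] the lowered index is -1, where the space is zero; otherwise induction applies.
       The same holds for [j] below. *)
    case: i {W} ltn iD uV {vV u'V} => [|i] ltn iD.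
      by rewrite Vspace_lt0 // memv0 => /eqP->; rewrite !mulmx0.
    by rewrite -(addn1 i) PoszD addrK; apply: IH => //; exact: ltnW.
  case: j {W} ltn jD u'V {vV uV} => [|j] ltn jD.
    by rewrite Vspace_lt0 ?orbT // memv0 => /eqP->; rewrite !mulmx0.
  rewrite -(addn1 j) PoszD addrK; apply: IH => //; last exact: ltnW.
  by rewrite -ltnS -addnS.
(* The projection [w] is covered by [W_eq], and the residue [v - w] lies in the orthogonal
   complement, where both matrices act by the same scalar. *)
have [w wW w_orth] := orthogonal_decomposition W v.
have wV : w \in Vspace e E x mu nu i j.
  by apply: subvP wW; rewrite subv_add !VspaceS // gerBl.
have vwT : in_Vtilde e E x mu nu i j (v - w) by split; first exact: memvB.
rewrite -[v](subrK w) !(mulmxDr _ (v - w)) (W_eq _ wW).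
by rewrite (NP _ _ iD jD _ vwT) (N'P _ _ iD jD _ vwT).
Qed.

Hypothesis E_real : forall i, map_mx Num.conj (E i) = E i.

Lemma Vspace_conj mu nu i j v : v \in Vspace e E x mu nu i j ->
  map_mx Num.conj v \in Vspace e E x mu nu i j.
Proof.
rewrite !memv_cap => /andP[vs vE].
by rewrite !partial_sum_conj // => k; apply: conj_dual_idempotent.
Qed.

Lemma in_Vtilde_conj mu nu i j v : in_Vtilde e E x mu nu i j v ->
  in_Vtilde e E x mu nu i j (map_mx Num.conj v).
Proof.
case=> vV v_orth; split; first exact: Vspace_conj.
move=> w /memv_addP[u uV [u' u'V ->]].
rewrite -(map_conjK (u + u')) hermitian_form_conj v_orth ?conjC0 //.
by rewrite map_mxD memv_add ?Vspace_conj.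
Qed.

(** Conjugate the action of [N] on the conjugate of [v], which lies in the same [Vtilde]. *)
Lemma scalar_on_Vtilde_conj mu nu f g (N : 'M[C]_#|X|) :
  (forall i j, (f i j)^* = g i j) -> scalar_on_Vtilde e E x N mu nu f ->
  scalar_on_Vtilde e E x (map_mx Num.conj N) mu nu g.
Proof.
move=> fg NP i j iD jD v /in_Vtilde_conj/(NP i j iD jD) Nv.
by rewrite -{1}(map_conjK v) -map_mxM Nv map_mxZ map_conjK /= fg.
Qed.

Lemma conj_tet_generator q (M M' : split_matrices C X) r :
  split_matrices_for e E x q M -> split_matrices_for e E x q^* M' ->
  map_mx Num.conj (tet_generator e E x q M r) = tet_generator e E x q^* M' r.
Proof.
move=> MP M'P.
(* The conjugate of [N] and the matrix [N'] solve the same scalar equations, so uniqueness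
   identifies them. *)
have conjE mu nu (f g : int -> int -> C) N N' :
    (forall i j, (f i j)^* = g i j) ->
    scalar_on_Vtilde e E x N mu nu f -> scalar_on_Vtilde e E x N' mu nu g ->
    map_mx Num.conj N = N'.
  by move=> fg /(scalar_on_Vtilde_conj fg); apply: scalar_on_Vtilde_uniq.
have powE n : (q ^ n)^* = q^* ^ n by exact: fmorphXz.
have BE := conjE _ _ _ _ _ _ (fun _ _ => powE _) (mxBP MP) (mxBP M'P).
have BsE := conjE _ _ _ _ _ _ (fun _ _ => powE _) (mxBsP MP) (mxBsP M'P).
have KE := conjE _ _ _ _ _ _ (fun _ _ => powE _) (mxKP MP) (mxKP M'P).
have KsE := conjE _ _ _ _ _ _ (fun _ _ => powE _) (mxKsP MP) (mxKsP M'P).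
have PhiE :=
  conjE _ _ _ _ _ _ (fun _ _ => powE _) (mxPhiP MP) (mxPhiP M'P).
have PsiE :=
  conjE _ _ _ _ _ _ (fun _ _ => powE _) (mxPsiP MP) (mxPsiP M'P).
have AE : map_mx Num.conj (mxA E q) = mxA E q^*.
  rewrite /mxA raddf_sum; apply: eq_bigr => i _.
  by rewrite /= map_mxZ E_real; congr (_ *: _); apply: powE.
have AsE : map_mx Num.conj (mxAs e D x q) = mxAs e D x q^*.
  rewrite /mxAs raddf_sum; apply: eq_bigr => i _.
  by rewrite /= map_mxZ conj_dual_idempotent; congr (_ *: _); apply: powE.
by case: r; rewrite /= ?map_mxM ?map_invmx ?AE ?AsE ?BE ?BsE ?KE ?KsE ?PhiE ?PsiE.
Qed.

End Spanning.

(** * Conjugates of square roots of real numbers *)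

Lemma conj_root (C : numClosedFieldType) (q : C) :
  q ^+ 2 \is Num.real -> q^* = q \/ q^* = - q.
Proof.
move=> /CrealP; rewrite rmorphXn => /eqP; rewrite eqf_sqr.
by case/orP=> /eqP; [left|right].
Qed.

(** The sign is decided by [0 <= q * q^*]: for [q^* = - q] this product would be [- q ^+ 2], which
    is negative. *)
Lemma sqrt_gt0_conj (C : numClosedFieldType) (q : C) : 0 < q ^+ 2 -> q^* = q.
Proof.
move=> q2; have [//|qN] := conj_root (gtr0_real q2).
have := mul_conjC_ge0 q; rewrite qN mulrN oppr_ge0 -expr2 => /(lt_le_trans q2).
by rewrite ltxx.
Qed.

Lemma sqrt_lt0_conj (C : numClosedFieldType) (q : C) : q ^+ 2 < 0 -> q^* = - q.
Proof.
move=> q2; have [qE|//] := conj_root (ltr0_real q2).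
have := mul_conjC_ge0 q; rewrite qE -expr2 => /le_lt_trans/(_ q2).
by rewrite ltxx.
Qed.

Theorem theorem9p4 (R : realType) (X : finType) (e : rel X) (D : nat)
    (p : nat -> nat -> nat -> nat) (b beta q : R[i])
    (E : 'I_D.+1 -> 'M[R[i]]_#|X|) (x : X)
    (M : split_matrices R[i] X) :
  symmetric e -> irreflexive e -> connected_graph e ->
  diameter e = D -> (3 <= D)%N ->
  distance_regular e p ->
  b != 1 -> classical_parameters p D b beta ->
  q ^+ 2 = b ->
  primitive_idempotents e E ->
  krein_parameters E (fun h i j => (p h i j)%:R) ->
  split_matrices_for e E x q M ->
  (1 < b ->
    forall r : tet_index,
      map_mx Num.conj (tet_generator e E x q M r) = tet_generator e E x q M r)
  /\
  (b < -1 ->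
    forall M' : split_matrices R[i] X, split_matrices_for e E x (- q) M' ->
    forall r : tet_index,
      map_mx Num.conj (tet_generator e E x q M r) =
        tet_generator e E x (- q) M' r).
Proof.
move=> e_sym _ _ diam _ dreg _ _ q2 EP _ MP.
have E1 := sum_primitive_idempotents e_sym diam dreg EP.
have E_real i : map_mx Num.conj (E i) = E i.
  apply: (primitive_idempotent_real e_sym diam dreg).
  by apply/EP.2; exists i.
split=> [b1 r | bN1 M' M'P r].
  (* The order on [R[i]] compares only numbers with real difference, so [1 < b] makes [b] a positive
     real. As [q] is then its own conjugate, [M] also serves as the family for [q^*]. *)
  have qE : q^* = q by apply: sqrt_gt0_conj; rewrite q2 (lt_trans ltr01).
  by rewrite (conj_tet_generator diam E1 E_real r MP (M' := M)) qE.
have qE : q^* = - q.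
  by apply: sqrt_lt0_conj; rewrite q2 (lt_trans bN1) // oppr_lt0.
by rewrite (conj_tet_generator diam E1 E_real r MP (M' := M')) qE.
Qed.
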